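(* Every affine isometric action of $\mathbf{Z}$ (with unitary linear part) on a complex Hilbert space can be extended to a continuous affine isometric action of $\mathbf{R}$.
   Context: An affine isometry of a complex Hilbert space $\mathcal{H}$ is a map $v\mapsto Uv+b$ with $U$ a unitary operator on $\mathcal{H}$ and $b\in\mathcal{H}$. An affine isometric action of a group on $\mathcal{H}$ is an action by affine isometries. ''Extended'' means that the restriction of the $\mathbf{R}$-action to $\mathbf{Z}\subset\mathbf{R}$ is the given action. *)

(* Defs.v *)
From mathcomp Require Import all_boot all_order all_algebra.
From mathcomp Require Import all_classical all_reals all_analysis.
From mathcomp.real_closed Require Export complex.
Set Implicit Arguments.
Unset Strict Implicit.
Unset Printing Implicit Defensive.
Import Order.TTheory GRing.Theory Num.Theory.
Import numFieldNormedType.Exports.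
Local Open Scope complex_scope.
Local Open Scope ring_scope.

(* A complex Hilbert space is a complete normed R[i]-module H, with R the real
   numbers, together with a positive definite Hermitian form dot whose
   associated norm is the norm of H.  The form is linear in its first
   argument and conjugate-linear in its second one. *)
Definition hilbert_form (R : realType) (H : completeNormedModType R[i])
    (dot : {dot H for Num.conj}) : Prop :=
  forall u : H, dot u u = `|u| ^+ 2.

Section AffineIsometries.
Variables (R : realType) (H : completeNormedModType R[i]).
Variable dot : {dot H for Num.conj}.

Definition unitary (U : {linear H -> H}) : Prop :=
  isometry dot dot U /\ bijective U.

Definition affine_isometry (f : H -> H) : Prop :=
  exists (U : {linear H -> H}) (b : H),
    unitary U /\ (forall v : H, f v = U v + b).

Definition affine_isometric_action (G : zmodType) (alpha : G -> H -> H)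
    : Prop :=
  [/\ forall g : G, affine_isometry (alpha g),
      forall v : H, alpha 0 v = v
    & forall (g h : G) (v : H), alpha (g + h) v = alpha g (alpha h v)].

End AffineIsometries.

(* Main.v *)
Require Import Defs.
From HB Require Import structures.
From mathcomp Require Import all_boot all_order all_algebra.
From mathcomp Require Import all_classical all_reals all_analysis.
From mathcomp Require Import ring lra.
Set Implicit Arguments.
Unset Strict Implicit.
Unset Printing Implicit Defensive.
Import Order.TTheory GRing.Theory Num.Theory.
Import numFieldNormedType.Exports.
Local Open Scope complex_scope.
Local Open Scope classical_set_scope.
Local Open Scope ring_scope.

(** Let f v = U v + b be the isometry given by the generator 1.  The idea is to
    extract compatible 2^n-th roots of f that tend to the identity
    geometrically, and to extend the resulting action of the dyadic rationals
    to the reals by continuity.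

    The spectral picture is that the square root of U is e^(i t/2) on the
    spectral value e^(i t), t in ]-pi, pi].  It has nonnegative real part, but
    it jumps at -1, so in general it is only a strong limit of polynomials in U
    and U^-1.  It is obtained without spectral theory: Newton's iteration for
    the polar decomposition, Z' = Z (3 - Z^* Z) / 2, started at the midpoint
    (1 + U) / 2 = e^(i t/2) cos (t/2), converges strongly to some Z that agrees with
    e^(i t/2) away from -1 and vanishes on ker (1 + U).  The defect
    E = 1 - Z^* Z is the projection onto ker (1 + U), and V = Z + i E is unitary
    with V^2 = U and Re V >= 0 ([unitary_sqrt]).  Convergence rests on
    monotonicity: |Z_n x| increases, and every operator of the iteration is Z_0
    times a polynomial with nonnegative coefficients in the positive operator
    defect Z_0 ([multiplier], [newton_iter_factor]).

    Since Re V >= 0, 1 + V is onto and |(1 + V) x|^2 >= 2 |x|^2.  Solving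
    c + V c = b gives an affine square root g of f, and f v - v is
    (1 + V) (g v - v), so g displaces v at most 1 / sqrt 2 <= 3 / 4 times as far
    as f does ([affine_isometry_sqrt]).  Iterating, f has 2^n-th roots whose
    displacement of v is O((3/4)^n) ([action_root_tower]).  Therefore
    A_n (floor (2^n t)) v, with A_n the action generated by the 2^n-th root, is a
    Cauchy sequence for each real t, with a geometric rate that is uniform in t;
    its limit is the required action ([flow_extension]).

    Estimates are written with the real-valued norm [nm] and the real inner
    product [ip], the real part of the Hermitian form.  Identities between
    vectors are often proved by pairing them with an arbitrary vector
    ([ip_ext]), which turns them into ring identities. *)

(** * Real sequences *)

Lemma cvg_squeeze_dist (R : realType) (f h : nat -> R) (l : R) :
  (forall n, `|f n - l| <= h n) -> h n @[n --> \oo] --> (0 : R) ->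
  f n @[n --> \oo] --> l.
Proof.
move=> fh h0; apply/subr_cvg0/norm_cvg0P/(squeeze_cvgr _ (cvg_cst 0) h0).
by near=> n; rewrite normr_ge0 fh.
Unshelve. all: by end_near. Qed.

Lemma cvg_eq_lim (R : realType) (f g : nat -> R) (l m : R) :
  f =1 g -> f n @[n --> \oo] --> l -> g n @[n --> \oo] --> m -> l = m.
Proof.
by move=> /funext -> gl gm; rewrite -(cvg_lim _ gl) // (cvg_lim _ gm).
Qed.

Lemma nondecreasing_cauchy (R : realType) (a : nat -> R) (M e : R) :
    nondecreasing_seq a -> (forall n, a n <= M) -> 0 < e ->
  exists N, forall n, (N <= n)%N -> a n - a N < e.
Proof.
move=> nda aM e0.
have cva : cvgn a.
  by apply: nondecreasing_is_cvgn => //; exists M => _ [n _ <-].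
have /cvgrPdist_lt /(_ _ e0) [N _ aN] := cva.
exists N => n Nn; have := aN N (leqnn N).
have := nondecreasing_cvgn_le nda cva n.
by move=> /= ? /(le_lt_trans (ler_norm _)); lra.
Qed.

(** * The real inner product and convergence in H *)

Section Hilbert.
Variables (R : realType) (H : completeNormedModType R[i]).
Variable dot : {dot H for Num.conj}.
Hypothesis Hdot : hilbert_form dot.

Definition nm (x : H) : R := complex.Re `|x|.
Definition ip (x y : H) : R := complex.Re (dot x y).

Lemma nmE x : `|x| = (nm x)%:C.
Proof.
have := normr_ge0 x; rewrite /nm; case: `|x| => a b.
by rewrite lecE /= => /andP[/eqP-> _].
Qed.

Lemma nm_ge0 x : 0 <= nm x.
Proof. by have := normr_ge0 x; rewrite nmE lecR. Qed.

Lemma nmD x y : nm (x + y) <= nm x + nm y.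
Proof. by have := ler_normD x y; rewrite !nmE -rmorphD lecR. Qed.

Lemma nmN x : nm (- x) = nm x.
Proof. by rewrite /nm normrN. Qed.

Lemma nmB x y : nm (x - y) = nm (y - x).
Proof. by rewrite /nm distrC. Qed.

Lemma nm0 : nm 0 = 0.
Proof. by rewrite /nm normr0. Qed.

Lemma nm0_eq0 x : nm x = 0 -> x = 0.
Proof. by move=> x0; apply/eqP; rewrite -normr_eq0 nmE x0. Qed.

Lemma ipC x y : ip x y = ip y x.
Proof.
have := hermC dot x y; rewrite /= expr0 mul1r /ip => ->.
by case: (dot y x).
Qed.

Lemma ipDl x y z : ip (x + y) z = ip x z + ip y z.
Proof. by rewrite /ip linearDl raddfD. Qed.

Lemma ipNl x z : ip (- x) z = - ip x z.
Proof. by rewrite /ip linearNl raddfN. Qed.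

Lemma ipZl (a : R) x z : ip (a%:C *: x) z = a * ip x z.
Proof.
have Re_scale (w : R[i]) : complex.Re (a%:C * w) = a * complex.Re w.
  by case: w => u v /=; ring.
by rewrite /ip linearZl_LR /= Re_scale.
Qed.

Lemma ipDr x y z : ip z (x + y) = ip z x + ip z y.
Proof. by rewrite ipC ipDl !(ipC z). Qed.

Lemma ipNr x z : ip z (- x) = - ip z x.
Proof. by rewrite ipC ipNl ipC. Qed.

Lemma ipZr (a : R) x z : ip z (a%:C *: x) = a * ip z x.
Proof. by rewrite ipC ipZl ipC. Qed.

Lemma ip_ir x y : ip x ('i *: y) = complex.Im (dot x y).
Proof.
have Re_conji (w : R[i]) : complex.Re ('i^* * w) = complex.Im w.
  by case: w => u v /=; ring.
by rewrite /ip linearZr_LR /= Re_conji.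
Qed.

(** Multiplication by i is skew-adjoint for the real inner product. *)
Lemma ip_i x y : ip ('i *: x) y = - ip x ('i *: y).
Proof.
have Re_i (w : R[i]) : complex.Re ('i * w) = - complex.Im w.
  by case: w => u v /=; ring.
by rewrite ip_ir /ip linearZl_LR /= Re_i.
Qed.

Lemma nm2 x : ip x x = nm x ^+ 2.
Proof. by rewrite /ip Hdot nmE -rmorphXn. Qed.

Definition ipE := (ipDl, ipDr, ipNl, ipNr, ipZl, ipZr).

Lemma ip_ext x y : (forall z, ip x z = ip y z) -> x = y.
Proof.
move=> xy; apply/eqP; rewrite -subr_eq0; apply/eqP/nm0_eq0/eqP.
by rewrite -[_ == 0](@expf_eq0 _ _ 2) -nm2 ipDl ipNl xy subrr.
Qed.

Lemma nmZ (a : R) x : nm (a%:C *: x) = `|a| * nm x.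
Proof.
apply/eqP; rewrite -(@eqrXn2 _ 2) ?mulr_ge0 ?nm_ge0 ?normr_ge0 //.
by rewrite -nm2 !ipE exprMn nm2 real_normK ?num_real // mulrA.
Qed.

Lemma ip_le x y : ip x y <= nm x * nm y.
Proof.
have := nmD x y; rewrite -ler_sqr ?nnegrE ?addr_ge0 ?nm_ge0 //.
by rewrite -nm2 !ipE !nm2 (ipC y x) sqrrD mulr2n; lra.
Qed.

Lemma ip_norm x y : `|ip x y| <= nm x * nm y.
Proof.
rewrite ler_norml ip_le andbT lerNl -ipNl -(nmN x); exact: ip_le.
Qed.

Lemma nm_sub x y : `|nm x - nm y| <= nm (x - y).
Proof.
have := nmD (x - y) y; have := nmD (y - x) x.
rewrite !subrK -(nmB x y) ler_norml; lra.
Qed.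

(** Convergence for the norm, with real-valued distances: the topology of H is
    indexed by radii in R[i]. *)
Definition tends (u : nat -> H) (l : H) : Prop :=
  nm (u n - l) @[n --> \oo] --> (0 : R).

(** Completeness of H, transported from positive radii in R[i], which are real,
    to real radii. *)
Lemma nm_complete (u : nat -> H) :
    (forall e : R, 0 < e ->
       exists N, forall n, (N <= n)%N -> nm (u n - u N) < e) ->
  exists l, tends u l.
Proof.
move=> cu.
have : cvg (u @ \oo).
  apply: cauchy_cvg; apply: cauchy_exP => -[e e'].
  rewrite ltcE /= => /andP[/eqP-> /cu[N uN]]; exists (u N), N => // n Nn.
  by rewrite /= -ball_normE /= distrC nmE ltcR uN.
move=> /cvg_ex[l ul]; exists l; apply/cvgrPdist_lt => e e0.
have /(_ e%:C) : forall e : R[i], 0 < e -> \forall n \near \oo, `|l - u n| < e.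
  by move=> e1 e10; move/cvgrPdist_lt : ul => /(_ _ e10).
rewrite ltcR => /(_ e0); apply: filterS => n.
by rewrite nmE ltcR sub0r normrN ger0_norm ?nm_ge0 // nmB.
Qed.

Lemma tends_squeeze (u : nat -> H) l (f : nat -> R) :
  (forall n, nm (u n - l) <= f n) -> f n @[n --> \oo] --> (0 : R) ->
  tends u l.
Proof.
move=> uf; apply: cvg_squeeze_dist => n.
by rewrite subr0 ger0_norm ?nm_ge0 // uf.
Qed.

Lemma tends_cst l : tends (fun=> l) l.
Proof. by rewrite /tends subrr nm0; exact: cvg_cst. Qed.

Lemma tendsD u v l m : tends u l -> tends v m ->
  tends (fun n => u n + v n) (l + m).
Proof.
move=> ul vm; apply: (@tends_squeeze _ _
  (fun n => nm (u n - l) + nm (v n - m))) => [n|].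
  by rewrite opprD addrACA nmD.
by rewrite -(addr0 (0 : R)); exact: cvgD.
Qed.

Lemma tends_lip (A : H -> H) (c : R) u l :
  (forall x y, nm (A x - A y) <= c * nm (x - y)) -> tends u l ->
  tends (A \o u) (A l).
Proof.
move=> Ac ul; apply: (@tends_squeeze _ _ (fun n => c * nm (u n - l))) => [n|].
  exact: Ac.
by rewrite -(mulr0 c); apply: cvgM => //; exact: cvg_cst.
Qed.

Lemma tends_nm u l : tends u l -> nm (u n) @[n --> \oo] --> nm l.
Proof. by apply: cvg_squeeze_dist => n; exact: nm_sub. Qed.

Lemma tends_ip u l x : tends u l -> ip (u n) x @[n --> \oo] --> ip l x.
Proof.
move=> ul; apply: (@cvg_squeeze_dist _ _ (fun n => nm (u n - l) * nm x)).
  by move=> n; rewrite -ipNl -ipDl ip_norm.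
by rewrite -(mul0r (nm x)); apply: cvgM => //; exact: cvg_cst.
Qed.

Lemma tends_unique u l m : tends u l -> tends u m -> l = m.
Proof.
move=> ul um; apply: ip_ext => x.
exact: (cvg_eq_lim (frefl _) (tends_ip ul) (tends_ip um)).
Qed.

Lemma tendsS u l : tends u l -> tends (fun n => u n.+1) l.
Proof.
by rewrite /tends => ul; rewrite -(cvg_shiftS (fun n => nm (u n - l))) in ul.
Qed.

Lemma tendsB u v l m : tends u l -> tends v m ->
  tends (fun n => u n - v n) (l - m).
Proof.
move=> ul vm; apply: (tendsD ul).
have Nc (y z : H) : nm (- y - - z) <= 1 * nm (y - z).
  by rewrite -opprD nmN mul1r.
exact: (tends_lip Nc).
Qed.

(** The differences are summable, and the geometric tail gives the rate.  The
    explicit rate is what later yields continuity at t = 0. *)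
Lemma geometric_cvg (u : nat -> H) (M q : R) : 0 <= q -> q < 1 ->
    (forall n, nm (u n.+1 - u n) <= M * q ^+ n) ->
  exists l, tends u l /\ forall n, nm (l - u n) <= M / (1 - q) * q ^+ n.
Proof.
move=> q0 q1 uM.
have q1' : 0 < 1 - q by rewrite subr_gt0.
have M0 : 0 <= M by have := le_trans (nm_ge0 _) (uM 0%N); rewrite expr0 mulr1.
pose K := M / (1 - q).
have K0 : 0 <= K by rewrite divr_ge0 ?(ltW q1').
have KM : M = K * (1 - q) by rewrite /K divfK ?gt_eqF.
have tail n k : nm (u (n + k)%N - u n) <= K * (q ^+ n - q ^+ (n + k)).
  elim: k => [|k IH]; first by rewrite addn0 !subrr nm0 mulr0.
  rewrite -(subrK (u (n + k)%N) (u (n + k.+1)%N)) -addrA.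
  apply: le_trans (nmD _ _) _; rewrite addnS.
  apply: le_trans (lerD (uM _) IH) _; rewrite KM exprS; lra.
have tail' n m : (n <= m)%N -> nm (u m - u n) <= K * q ^+ n.
  move=> nm; rewrite -(subnKC nm); apply: le_trans (tail _ _) _.
  by rewrite ler_wpM2l // gerBl exprn_ge0.
have Kq0 : (K * q ^+ n) @[n --> \oo] --> (0 : R).
  by have := @cvg_geometric R K q; rewrite ger0_norm // => /(_ q1).
have [l ul] : exists l, tends u l.
  apply: nm_complete => e e0.
  have /cvgrPdist_lt /(_ _ e0) [N _ NP] := Kq0.
  exists N => n Nn; apply: le_lt_trans (tail' _ _ Nn) _.
  by have := NP N (leqnn N); rewrite sub0r normrN => /(le_lt_trans (ler_norm _)).
exists l; split=> // n.
have uln : tends (fun m => u m - u n) (l - u n) := tendsD ul (tends_cst _).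
apply: (cvgr_to_le (tends_nm uln)); near=> m.
by apply: tail'; near: m; exists n.
Unshelve. all: by end_near. Qed.

(** Strong convergence of contractions is jointly continuous with the argument:
    |A_n u_n - m| <= |u_n - l| + |A_n l - m|. *)
Lemma tends_app (A : nat -> {linear H -> H}) (u : nat -> H) (l m : H) :
    (forall n x, nm (A n x) <= nm x) -> tends (fun n => A n l) m ->
  tends u l -> tends (fun n => A n (u n)) m.
Proof.
move=> Ac Alm ul.
apply: (@tends_squeeze _ _ (fun n => nm (u n - l) + nm (A n l - m))) => [n|].
  apply: le_trans (lerD (Ac n _) (lexx _)).
  by rewrite linearB -{1}(subrK (A n l) (A n (u n))) -addrA nmD.
by rewrite -(addr0 (0 : R)); exact: cvgD.
Qed.

Definition linear_map (f : H -> H) (lf : linear f) : {linear H -> H} :=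
  HB.pack f (GRing.isLinear.Build R[i] H H *:%R f lf).

Lemma tends_linear (Z : nat -> {linear H -> H}) (L : H -> H) :
    (forall n x, nm (Z n x) <= nm x) ->
    (forall x, tends (fun n => Z n x) (L x)) -> linear L.
Proof.
move=> Zc ZL a x y; apply: (@tends_unique (fun n => Z n (a *: x + y))) => //.
have aL : tends (fun n => a *: Z n x) (a *: L x).
  apply: (@tends_lip ( *:%R a) (complex.Re `|a|)) (ZL x) => u v.
  rewrite -scalerBr /nm normrZ; have := normr_ge0 a.
  case: `|a| => p q; rewrite lecE /= => /andP[/eqP-> _].
  by rewrite -[`|u - v|]/(`|u - v|) nmE /= mul0r subr0.
have := tendsD aL (ZL y); congr tends; apply/funext => n.
by rewrite linearP.
Qed.

(** * The square root of a unitary operator *)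

Section Root.
Variables U Ui : {linear H -> H}.
Hypothesis nmU : forall x, nm (U x) = nm x.
Hypotheses (UK : cancel U Ui) (UiK : cancel Ui U).

(** Polarization. *)
Lemma ipU x y : ip (U x) (U y) = ip x y.
Proof.
have pol (a b : H) : ip a b = (nm (a + b) ^+ 2 - nm a ^+ 2 - nm b ^+ 2) / 2.
  by rewrite -!nm2 !ipE (ipC b a); field.
by rewrite !pol -linearD !nmU.
Qed.

Lemma ip_adjU x y : ip (U x) y = ip x (Ui y).
Proof. by rewrite -[y in LHS]UiK ipU. Qed.

(** Z commutes with U and has adjoint U^-1 Z.  On the spectral value e^(i t) this
    says that Z is e^(i t/2) times a real number, so that only the modulus of Z
    remains to be corrected. *)
Definition half_angle (Z : H -> H) : Prop :=
  (forall x, Z (U x) = U (Z x)) /\ (forall x y, ip (Z x) y = ip x (Ui (Z y))).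

Lemma commUi (Z : H -> H) : (forall x, Z (U x) = U (Z x)) ->
  forall x, Z (Ui x) = Ui (Z x).
Proof. by move=> ZU x; rewrite -[in RHS](UiK x) ZU UK. Qed.

(** This is 1 - Z^* Z when Z satisfies [half_angle]; it measures how far Z is
    from being isometric. *)
Definition defect (Z : H -> H) (x : H) : H := x - Ui (Z (Z x)).

Section Linear.
Variable Z : {linear H -> H}.

Lemma defect_is_linear : linear (defect Z).
Proof.
move=> a x y; rewrite /defect linearP /= linearP /= linearP /=.
by rewrite scalerBr opprD addrACA.
Qed.
HB.instance Definition _ :=
  GRing.isLinear.Build R[i] H H *:%R (defect Z) defect_is_linear.

(** Newton's step Z (3 - Z^* Z) / 2 for the isometric factor of Z. *)
Definition newton (x : H) : H := Z x + (2^-1)%:C *: Z (defect Z x).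

Lemma newton_is_linear : linear newton.
Proof.
move=> a x y; rewrite /newton linearP /= linearP /= linearP /=.
by rewrite !scalerDr !scalerA (mulrC _ a) addrACA.
Qed.
HB.instance Definition _ :=
  GRing.isLinear.Build R[i] H H *:%R newton newton_is_linear.

Hypothesis aZ : half_angle Z.
Let ZU : forall x, Z (U x) = U (Z x) := proj1 aZ.
Let ZUi := commUi ZU.
Let Zadj : forall x y, ip (Z x) y = ip x (Ui (Z y)) := proj2 aZ.

Lemma defectU x : defect Z (U x) = U (defect Z x).
Proof. by rewrite /defect !ZU linearB /= UK UiK. Qed.

Lemma defectUi x : defect Z (Ui x) = Ui (defect Z x).
Proof. by rewrite (commUi defectU). Qed.

Lemma defectZ x : defect Z (Z x) = Z (defect Z x).
Proof. by rewrite /defect linearB /= ZUi. Qed.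

Lemma defect_adj x y : ip (defect Z x) y = ip x (defect Z y).
Proof.
rewrite /defect !ipE; congr (_ - _).
by rewrite -ZUi -ZUi !Zadj -ipU !UiK ZUi.
Qed.

Lemma nm_half_angle x : nm (Z x) ^+ 2 = nm x ^+ 2 - ip (defect Z x) x.
Proof. by rewrite -!nm2 Zadj /defect ipDl ipNl (ipC x (Ui _)); ring. Qed.

Lemma half_angle_newton : half_angle newton.
Proof.
split=> [x|x y]; first by rewrite /newton defectU !ZU (linearD U) (linearZ_LR U).
rewrite /newton !ipE !(linearD Ui) !(linearZ_LR Ui) /=.
by rewrite !ipE !Zadj defect_adj defectUi defectZ.
Qed.

(** With D the defect of Z, Z^* Z = 1 - D and the step multiplies Z by
    1 + D / 2, so the new defect is 1 - (1 - D) (1 + D / 2)^2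
    = 3/4 D^2 + 1/4 D^3.  The coefficients are nonnegative, so the defect stays
    positive along the iteration. *)
Lemma defect_newton x : defect newton x =
  (3 / 4)%:C *: defect Z (defect Z x)
  + (4^-1)%:C *: defect Z (defect Z (defect Z x)).
Proof.
pose k y := y + (2^-1)%:C *: defect Z y.
have nk y : newton y = Z (k y) by rewrite (linearD Z) (linearZ_LR Z).
have kZ y : k (Z y) = Z (k y) by rewrite -nk /k defectZ.
have Q y : Ui (Z (Z y)) = y - defect Z y.
  by rewrite /defect opprB addrC subrK.
have -> : defect newton x = x - (k (k x) - defect Z (k (k x))).
  by rewrite -Q -kZ -nk -nk.
have Dk y : defect Z (k y) = k (defect Z y).
  by rewrite (linearD (defect Z)) (linearZ_LR (defect Z)).
have kk y : k (k y) = k y + (2^-1)%:C *: k (defect Z y) by rewrite {1}/k Dk.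
by rewrite !Dk !kk; apply: ip_ext => z; rewrite /k !ipE; field.
Qed.
End Linear.

(** Products of commuting positive operators are positive, but this needs square
    roots.  The class of the operators B for which A B is positive as soon as A
    is positive and commutes with U is visibly closed under products, sums and
    nonnegative scalars, and it contains the operators needed here. *)
Definition multiplier (B : {linear H -> H}) : Prop :=
  (forall x, B (U x) = U (B x)) /\
  (forall A : {linear H -> H}, (forall x, A (U x) = U (A x)) ->
     (forall x, 0 <= ip (A x) x) -> forall x, 0 <= ip (A (B x)) x).

Lemma multiplier_comp (B C : {linear H -> H}) :
  multiplier B -> multiplier C -> multiplier (B \o C).
Proof.
move=> [BU Bp] [CU Cp]; split=> [x|A AU Ap x] /=; first by rewrite CU BU.
by apply: (Cp (A \o B)) => [y|y] /=; [rewrite BU AU | exact: Bp].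
Qed.

Lemma multiplier_add (B C : {linear H -> H}) :
  multiplier B -> multiplier C -> multiplier (B \+ C).
Proof.
move=> [BU Bp] [CU Cp]; split=> [x|A AU Ap x] /=.
  by rewrite CU BU -linearD.
by rewrite linearD ipDl addr_ge0 ?Bp ?Cp.
Qed.

Lemma multiplier_scale (a : R) (B : {linear H -> H}) : 0 <= a ->
  multiplier B -> multiplier (a%:C \*: B).
Proof.
move=> a0 [BU Bp]; split=> [x|A AU Ap x] /=; first by rewrite BU linearZ.
by rewrite linearZ_LR ipZl mulr_ge0 ?Bp.
Qed.

Lemma multiplier_id : multiplier idfun.
Proof. by split=> // A _ Ap x; exact: Ap. Qed.

Lemma multiplier_ge0 (B : {linear H -> H}) x : multiplier B -> 0 <= ip (B x) x.
Proof.
by case=> _ /(_ idfun); apply => // y; rewrite nm2 sqr_ge0.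
Qed.

Lemma multiplier_eq (B C : {linear H -> H}) :
  B =1 C -> multiplier B -> multiplier C.
Proof.
move=> BC [BU Bp]; split=> [x|A AU Ap x]; first by rewrite -!BC.
by rewrite -BC Bp.
Qed.

(** The starting point, e^(i t/2) cos (t/2) on the spectral value e^(i t). *)
Definition midpoint (x : H) : H := (2^-1)%:C *: (x + U x).

Lemma midpoint_is_linear : linear midpoint.
Proof.
move=> a x y; rewrite /midpoint linearP /= [a *: (_ *: _)]scalerA (mulrC a).
by rewrite -scalerA -scalerDr (scalerDr a) addrACA.
Qed.
HB.instance Definition _ :=
  GRing.isLinear.Build R[i] H H *:%R midpoint midpoint_is_linear.

Lemma half_angle_midpoint : half_angle midpoint.
Proof.
split=> [x|x y]; first by rewrite /midpoint -linearD linearZ.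
by rewrite /midpoint (linearZ_LR Ui) (linearD Ui) !ipE ip_adjU UK addrC.
Qed.

(** The first defect is Y^* Y with Y = (1 - U) / 2, hence
    ip (A (Y^* Y x)) x = ip (A (Y x)) (Y x). *)
Lemma multiplier_defect_midpoint : multiplier (defect midpoint).
Proof.
split=> [x|A AU Ap x]; first exact: (defectU half_angle_midpoint).
suff -> : ip (A (defect midpoint x)) x = 4^-1 * ip (A (x - U x)) (x - U x).
  by rewrite mulr_ge0 ?invr_ge0.
have -> : defect midpoint x = x - (4^-1)%:C *: (Ui x + x + (x + U x)).
  rewrite /defect /midpoint (linearZ_LR U) -scalerDr scalerA (linearZ_LR Ui).
  rewrite (linearD U) !(linearD Ui) !UK -rmorphM; congr (_ - _%:C *: _).
  by field.
rewrite !(linearB A) (linearZ_LR A) !(linearD A) (commUi AU) AU !ipE ipU.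
have -> : ip (Ui (A x)) x = ip (A x) (U x) by rewrite ipC -ip_adjU ipC.
by field.
Qed.

Fixpoint newton_iter (n : nat) : {linear H -> H} :=
  if n is m.+1 then newton (newton_iter m) else midpoint.

Lemma half_angle_newton_iter n : half_angle (newton_iter n).
Proof.
elim: n => [|n /= aZ]; first exact: half_angle_midpoint.
exact: half_angle_newton.
Qed.

Lemma multiplier_defect n : multiplier (defect (newton_iter n)).
Proof.
elim: n => [|n mD]; first exact: multiplier_defect_midpoint.
pose D : {linear H -> H} := defect (newton_iter n).
have a0 : 0 <= 3 / 4 :> R by rewrite divr_ge0.
have b0 : 0 <= 4^-1 :> R by rewrite invr_ge0.
have mDD : multiplier (D \o D) := multiplier_comp mD mD.
have mDDD : multiplier (D \o (D \o D)) := multiplier_comp mD mDD.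
have := multiplier_add (multiplier_scale a0 mDD) (multiplier_scale b0 mDDD).
apply: multiplier_eq => x /=.
by rewrite (defect_newton (half_angle_newton_iter n)).
Qed.

(** Each step multiplies by 1 + D / 2 with D a multiplier, and a product of
    factors 1 + B with B a multiplier has the same form. *)
Lemma newton_iter_factor n k : exists B : {linear H -> H}, multiplier B /\
  forall x, newton_iter (n + k) x = newton_iter n (x + B x).
Proof.
elim: k => [|k [B [mB ZB]]].
  exists (0%:C \*: idfun); split; first exact/multiplier_scale/multiplier_id.
  by move=> x /=; rewrite addn0 scale0r addr0.
have [D mD DE] : exists2 D : {linear H -> H}, multiplier D &
    forall x, newton_iter (n + k).+1 x = newton_iter (n + k) (x + D x).
  exists ((2^-1)%:C \*: defect (newton_iter (n + k))).
    by apply: multiplier_scale (multiplier_defect _); rewrite invr_ge0.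
  by move=> x; rewrite (linearD (newton_iter _)) (linearZ_LR (newton_iter _)).
exists (D \+ (B \+ (B \o D))); split=> [|x].
  exact/(multiplier_add mD)/(multiplier_add mB)/multiplier_comp.
by rewrite addnS DE ZB (linearD B) -addrA.
Qed.

Lemma nm_newton_iter_le n x : nm (newton_iter n x) <= nm x.
Proof.
rewrite -ler_sqr ?nnegrE ?nm_ge0 // (nm_half_angle (half_angle_newton_iter n)).
by rewrite gerBl (multiplier_ge0 x (multiplier_defect n)).
Qed.

(** Z_(n+k) = Z_n (1 + B) with Z_n^* Z_n B positive, hence
    ip (Z_(n+k) x) (Z_n x) >= |Z_n x|^2; expand the square of the difference. *)
Lemma newton_iter_dist n k x :
  nm (newton_iter (n + k) x - newton_iter n x) ^+ 2 <=
  nm (newton_iter (n + k) x) ^+ 2 - nm (newton_iter n x) ^+ 2.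
Proof.
have [B [[_ Bp] ZB]] := newton_iter_factor n k.
have [ZU Zadj] := half_angle_newton_iter n.
have ZZB : 0 <= ip (newton_iter n x) (newton_iter n (B x)).
  rewrite Zadj ipC; apply: (Bp (Ui \o (newton_iter n \o newton_iter n))) => y /=.
    by rewrite !ZU UK UiK.
  by rewrite ipC -Zadj nm2 sqr_ge0.
rewrite -!nm2 ZB (linearD (newton_iter n)) !ipE.
rewrite (ipC (newton_iter n (B x)) (newton_iter n x)).
lra.
Qed.

(** |Z_n x|^2 is nondecreasing and bounded by |x|^2, hence Cauchy, and
    [newton_iter_dist] transfers this to Z_n x. *)
Lemma newton_iter_cvg x : exists l, tends (fun n => newton_iter n x) l.
Proof.
apply: nm_complete => e e0.
have nd : nondecreasing_seq (fun n => nm (newton_iter n x) ^+ 2).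
  move=> n m nm; rewrite -(subnKC nm) -subr_ge0.
  exact: le_trans (sqr_ge0 _) (newton_iter_dist _ _ _).
have bd n : nm (newton_iter n x) ^+ 2 <= nm x ^+ 2.
  by rewrite ler_sqr ?nnegrE ?nm_ge0 ?nm_newton_iter_le.
have [N NP] := nondecreasing_cauchy nd bd (exprn_gt0 2 e0).
exists N => n Nn; rewrite -ltr_sqr ?nnegrE ?nm_ge0 ?(ltW e0) //.
rewrite -{1}(subnKC Nn); apply: le_lt_trans (newton_iter_dist _ _ _) _.
by rewrite subnKC // NP.
Qed.

(** With Z the strong limit and E its defect, passing to the limit in Newton's
    step gives Z = Z (1 + E / 2), so Z E = 0 and E is a self-adjoint projection;
    moreover U = -1 on the range of E.  Then V = Z + i E satisfies
    V^2 = Z^2 - E = U (1 - E) - E = U and V^* V = (1 - E) + E = 1. *)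
Lemma unitary_sqrt : exists V : {linear H -> H},
  [/\ forall x, V (V x) = U x, forall x, nm (V x) = nm x
    & forall x, 0 <= ip (V x) x].
Proof.
have [Z ZL] : exists Z : {linear H -> H}, forall x,
    tends (fun n => newton_iter n x) (Z x).
  have [L ZL] := choice newton_iter_cvg.
  by exists (linear_map (tends_linear nm_newton_iter_le ZL)).
have Zc x y : nm (Z x - Z y) <= 1 * nm (x - y).
  rewrite mul1r -linearB; apply: (cvgr_to_le (tends_nm (ZL (x - y)))).
  by near=> n; exact: nm_newton_iter_le.
have Uc (x y : H) : nm (U x - U y) <= 1 * nm (x - y).
  by rewrite -linearB nmU mul1r.
have Uic (x y : H) : nm (Ui x - Ui y) <= 1 * nm (x - y).
  by rewrite -linearB -nmU UiK mul1r.
have aZ : half_angle Z.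
  split=> [x|x y].
    apply: tends_unique (ZL (U x)) _.
    have := tends_lip Uc (ZL x); congr tends; apply/funext => n.
    by have [/= -> _] := half_angle_newton_iter n.
  have h1 := tends_ip (x := y) (ZL x).
  have h2 := tends_ip (x := x) (tends_lip Uic (ZL y)).
  rewrite [RHS]ipC; apply: cvg_eq_lim h1 h2 => n /=.
  by have [_ ->] := half_angle_newton_iter n; rewrite ipC.
have ZU := proj1 aZ; have Zadj := proj2 aZ.
pose E : {linear H -> H} := defect Z.
have EL x : tends (fun n => defect (newton_iter n) x) (E x).
  apply: (tendsB (tends_cst x)); apply: (tends_lip Uic).
  exact: (tends_app nm_newton_iter_le (ZL (Z x)) (ZL x)).
have ZE x : Z (E x) = 0.
  have Z1 := tendsS (ZL x).
  have hc (y z : H) : nm ((2^-1)%:C *: y - (2^-1)%:C *: z) <= 2^-1 * nm (y - z).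
    by rewrite -scalerBr nmZ ger0_norm ?invr_ge0.
  have Z2 := tendsD (ZL x)
    (tends_lip hc (tends_app nm_newton_iter_le (ZL (E x)) (EL x))).
  have /eqP := tends_unique Z1 Z2.
  rewrite -subr_eq0 opprD addNKr oppr_eq0 scaler_eq0 => /orP[|/eqP//].
  by rewrite fmorph_eq0 invr_eq0 pnatr_eq0.
(* |Z_n y| increases from |(1 + U) y| / 2 to |Z y|, which is 0 for y = E x. *)
have UE x : U (E x) = - E x.
  have /eqP : midpoint (E x) = 0.
    apply/nm0_eq0/eqP; rewrite eq_le nm_ge0 andbT -[leRHS]nm0 -(ZE x).
    apply: (cvgr_to_ge (tends_nm (ZL (E x)))); near=> n.
    rewrite -ler_sqr ?nnegrE ?nm_ge0 // -subr_ge0.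
    exact: le_trans (sqr_ge0 _) (newton_iter_dist 0 n (E x)).
  rewrite scaler_eq0 fmorph_eq0 invr_eq0 pnatr_eq0 /= addrC addr_eq0.
  by move/eqP.
have EZ x : E (Z x) = 0 := etrans (defectZ aZ x) (ZE x).
have EE x : E (E x) = E x.
  by rewrite -[LHS]/(E x - Ui (Z (Z (E x)))) ZE (linear0 Z) (linear0 Ui) subr0.
have Eadj x y : ip (E x) y = ip x (E y) := defect_adj aZ x y.
have iE x : ip ('i *: E x) x = 0.
  have := ip_i (E x) x; rewrite Eadj -linearZ /= ipC; lra.
pose V : {linear H -> H} := Z \+ ('i \*: E).
exists V; split=> x.
- rewrite /V /= !(linearD Z) !(linearD E) !(linearZ_LR Z) !(linearZ_LR E) /=.
  have UiZZ : Ui (Z (Z x)) = x - E x by rewrite /E /= /defect opprB addrC subrK.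
  rewrite ZE EZ EE scaler0 addr0 add0r scalerA -expr2 sqr_i scaleN1r.
  by rewrite -[Z (Z x)]UiK UiZZ linearB UE opprK addrK.
- apply/eqP; rewrite -(@eqrXn2 _ 2) ?nm_ge0 // -!nm2 /V /= !ipE.
  have ZiE : ip (Z x) ('i *: E x) = 0.
    by rewrite -(linearZ_LR E) Zadj ZE linear0 -(scale0r x) (ipZr 0) mul0r.
  have -> : ip ('i *: E x) ('i *: E x) = ip (E x) x.
    by rewrite ip_i scalerA -expr2 sqr_i scaleN1r ipNr opprK -Eadj EE.
  rewrite (ipC ('i *: E x)) ZiE Zadj -[Ui _](subKr x) -/(defect Z x) ipDr ipNr.
  by rewrite (ipC x (defect Z x)) addr0 add0r subrK.
(* The real part of i E is 0, so that only Z matters; Z_n is Z_0 (1 + B) with B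
     a multiplier, and Z_0 has nonnegative real part because U is isometric. *)
- rewrite /V /= ipDl iE addr0; apply: (cvgr_to_ge (tends_ip (ZL x))).
  near=> n; have [B [mB /(_ x) ->]] := newton_iter_factor 0 n.
  have mid0 y : 0 <= ip (midpoint y) y.
    rewrite /midpoint !ipE mulr_ge0 ?invr_ge0 // nm2.
    have := ip_norm (U y) y; rewrite nmU -expr2 ler_norml; lra.
  rewrite (linearD midpoint) ipDl addr_ge0 //=.
  by have [_ /(_ midpoint)] := mB; apply=> //; case: half_angle_midpoint.
Unshelve. all: by end_near. Qed.

End Root.

(** * Affine isometries and their square roots *)

(** A solution is a fixed point of c |-> c - (V c + c - b) / 4, whose linear part
    W satisfies |W x|^2 = 5/8 |x|^2 - 3/8 ip (V x) x <= (7/8)^2 |x|^2. *)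
Lemma accretive_onto (V : {linear H -> H}) (b : H) :
    (forall x, nm (V x) = nm x) -> (forall x, 0 <= ip (V x) x) ->
  exists c, V c + c = b.
Proof.
move=> nV pV.
pose T x := x - (4^-1)%:C *: (V x + x - b).
have Tq x y : nm (T x - T y) <= 7 / 8 * nm (x - y).
  have -> : T x - T y = (x - y) - (4^-1)%:C *: (V (x - y) + (x - y)).
    by rewrite /T (linearB V); apply: ip_ext => z; rewrite !ipE; field.
  move: (x - y) => {x y} z.
  rewrite -ler_sqr ?nnegrE ?mulr_ge0 ?divr_ge0 ?nm_ge0 // exprMn -!nm2 !ipE.
  have := pV z; have := nV z; have : nm (V z) ^+ 2 = ip (V z) (V z) by rewrite nm2.
  move=> + nVz; rewrite nVz -nm2 (ipC z (V z)) => <-.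
  by have := sqr_ge0 (nm z); rewrite -nm2 => *; nra.
pose u n := iter n T 0.
have uq n : nm (u n.+1 - u n) <= nm (u 1%N - u 0%N) * (7 / 8) ^+ n.
  elim: n => [|n IH]; first by rewrite expr0 mulr1.
  rewrite exprS mulrCA; apply: le_trans (Tq _ _) _.
  by rewrite ler_wpM2l // divr_ge0.
have q0 : 0 <= 7 / 8 :> R by lra.
have q1 : 7 / 8 < 1 :> R by lra.
have [c [uc _]] := geometric_cvg q0 q1 uq.
exists c; have /eqP := tends_unique (tends_lip Tq uc) (tendsS uc).
rewrite /T addrC -subr_eq0 addrK oppr_eq0 scaler_eq0 fmorph_eq0 invr_eq0.
by rewrite pnatr_eq0 /= subr_eq0 => /eqP.
Qed.

(** The imaginary part of the Hermitian form is the real inner product with i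
    times the second argument, so the real polarization identity suffices. *)
Lemma unitary_of_nm (U : {linear H -> H}) :
  (forall x, nm (U x) = nm x) -> bijective U -> unitary dot U.
Proof.
move=> nU bU; split=> // x y; apply/eqP; rewrite eq_complex; apply/andP; split.
  exact/eqP/(ipU nU).
by apply/eqP; rewrite -!ip_ir -linearZ (ipU nU).
Qed.

Lemma nm_unitary (U : {linear H -> H}) x : unitary dot U -> nm (U x) = nm x.
Proof.
case=> isoU _; apply/eqP; rewrite -(@eqrXn2 _ 2) ?nm_ge0 //.
by rewrite -!nm2 /ip isoU.
Qed.

Lemma nm_affine f x y : affine_isometry dot f -> nm (f x - f y) = nm (x - y).
Proof.
move=> [U [b [uU fE]]]; rewrite !fE opprD addrACA subrr addr0 -linearB.
exact: nm_unitary.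
Qed.

Lemma affine_isometry_id : affine_isometry dot id.
Proof.
exists idfun, 0; split=> [|v]; last by rewrite addr0.
by apply: unitary_of_nm => //; exists id.
Qed.

Lemma affine_isometry_comp f g : affine_isometry dot f -> affine_isometry dot g ->
  affine_isometry dot (f \o g).
Proof.
move=> [U [b [[isoU bU] fE]]] [V [c [[isoV bV] gE]]].
exists (U \o V), (U c + b); split=> [|v]; last by rewrite /= fE gE linearD addrA.
by split; [move=> x y /=; rewrite isoU isoV | exact: bij_comp].
Qed.

Lemma affine_isometry_inv f : affine_isometry dot f ->
  exists g, [/\ affine_isometry dot g, cancel f g & cancel g f].
Proof.
move=> [U [b [uU fE]]]; have [isoU [W UK WK]] := uU.
pose Ui := linear_map (can2_linear UK WK).
exists (fun v => Ui v + - Ui b); split=> [|v|v].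
- exists Ui, (- Ui b); split=> //; apply: unitary_of_nm; last by exists U.
  by move=> x; rewrite -(nm_unitary (Ui x) uU) /= WK.
- by rewrite fE -linearB /= addrK UK.
- by rewrite fE -linearB /= WK subrK.
Qed.

(** The linear part is the square root V of [unitary_sqrt].  With
    d = g v - v one has f v - v = V d + d, and Re V >= 0 gives
    |V d + d|^2 >= 2 |d|^2 >= (4/3)^2 |d|^2. *)
Lemma affine_isometry_sqrt f : affine_isometry dot f -> exists g,
  [/\ affine_isometry dot g, forall v, g (g v) = f v
    & forall v, nm (g v - v) <= 3 / 4 * nm (f v - v)].
Proof.
move=> [U [b [uU fE]]]; have [isoU [W UK WK]] := uU.
pose Ui := linear_map (can2_linear UK WK).
have nU x : nm (U x) = nm x by apply: nm_unitary.
have [V [VV nV pV]] := @unitary_sqrt U Ui nU UK WK.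
have [c cb] := accretive_onto b nV pV.
pose g v := V v + c; exists g.
have ggf v : g (g v) = f v by rewrite /g fE linearD VV -addrA cb.
split=> // [|v].
  exists V, c; split=> //; apply: unitary_of_nm => //.
  have VU x : V (U x) = U (V x) by rewrite -!VV.
  have WV x : W (V x) = V (W x) by rewrite -[in LHS](WK x) VU UK.
  by exists (W \o V) => x /=; rewrite -?WV VV UK.
have -> : f v - v = V (g v - v) + (g v - v).
  rewrite -ggf -(subrK (g v) (g (g v))) -addrA {1 2}/g; congr (_ + _).
  by rewrite opprD addrACA subrr addr0 -linearB.
move: (g v - v) => d.
rewrite -ler_sqr ?nnegrE ?mulr_ge0 ?divr_ge0 ?nm_ge0 // exprMn -!nm2 !ipE.
rewrite (ipC d (V d)) (nm2 (V d)) nV -nm2; have := pV d.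
by have := sqr_ge0 (nm d); rewrite -nm2; lra.
Qed.

(** * Actions of the integers and their roots *)

(** A recursion along an injective map determines a two-sided sequence. *)
Lemma int_orbit_ext (g : H -> H) (p q : int -> H) : injective g ->
    (forall k, p (k + 1) = g (p k)) -> (forall k, q (k + 1) = g (q k)) ->
  p 0 = q 0 -> p =1 q.
Proof.
move=> gI pS qS pq0; elim=> [//|n IH|n IH].
  by rewrite intS addrC pS qS IH.
by apply: gI; rewrite -pS -qS intS opprD addrAC addNr add0r.
Qed.

Lemma action_of_affine g : affine_isometry dot g ->
  exists a : int -> H -> H, affine_isometric_action dot a /\ a 1 = g.
Proof.
move=> ag; have [gi [agi gK giK]] := affine_isometry_inv ag.
pose a (k : int) v :=
  match k with Posz n => iter n g v | Negz n => iter n.+1 gi v end.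
have aS k v : a (k + 1) v = g (a k v).
  case: k => n; first by rewrite -PoszD addn1.
  rewrite NegzE intS opprD addrAC addNr add0r.
  by case: n => [|n]; rewrite -?NegzE /= giK.
have affi f n : affine_isometry dot f -> affine_isometry dot (iter n f).
  move=> af; elim: n => [|n IH]; first exact: affine_isometry_id.
  exact: affine_isometry_comp af IH.
exists a; split=> //; split=> // [[n|n]|j k v].
- exact: affi.
- exact: affi n.+1 agi.
- move: j; apply: (@int_orbit_ext g (fun j => a (j + k) v)) => [|j|j|].
  + exact: can_inj gK.
  + by rewrite addrAC aS.
  + exact: aS.
  + by rewrite add0r.
Qed.

Section Action.
Variables (G : zmodType) (a : G -> H -> H).
Hypothesis act_a : affine_isometric_action dot a.

Lemma action_nm k x y : nm (a k x - a k y) = nm (x - y).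
Proof. by have [aff _ _] := act_a; apply: nm_affine. Qed.

Lemma actionD k l v : a (k + l) v = a k (a l v).
Proof. by have [_ _ ->] := act_a. Qed.

End Action.

Lemma action_sqrt (a : int -> H -> H) : affine_isometric_action dot a ->
  exists a' : int -> H -> H,
  [/\ affine_isometric_action dot a', forall (k : int) v, a' (k + k) v = a k v
    & forall v, nm (a' 1 v - v) <= 3 / 4 * nm (a 1 v - v)].
Proof.
move=> [aff a0 aD].
have [g [ag gg gle]] := affine_isometry_sqrt (aff 1).
have [a' [act_a' a'1]] := action_of_affine ag; have [_ a'0 a'D] := act_a'.
exists a'; split=> //; last by rewrite a'1.
move=> k v; have a1I : injective (a 1).
  by move=> x y xy; rewrite -(a0 x) -(a0 y) -(addNr 1) !aD xy.
move: k; apply: (@int_orbit_ext _ (fun k => a' (k + k) v) _ a1I) => [k|k|].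
- by rewrite addrACA addrC !a'D a'1 gg.
- by rewrite addrC aD.
- by rewrite addr0 a'0 a0.
Qed.

(** * The flow *)

Lemma floorD (x y : R) : Num.floor (x + y) = Num.floor x + Num.floor y \/
  Num.floor (x + y) = Num.floor x + Num.floor y + 1.
Proof.
have /andP[] := floor_itv x; have /andP[] := floor_itv y.
set m := Num.floor y; set n := Num.floor x; rewrite !intrD => y1 y2 x1 x2.
have [xy|xy] := ltP (x + y) (n + m + 1)%:~R; [left|right]; apply: floor_def;
  move: xy; rewrite !intrD => ?; apply/andP; split; lra.
Qed.

Section Flow.
Variable alpha : int -> H -> H.
Hypothesis act_alpha : affine_isometric_action dot alpha.

(** Roots are not unique, so the tower is built by choosing one for each
    action. *)
Lemma action_root_tower : exists A : nat -> int -> H -> H,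
  [/\ A 0%N = alpha, forall n, affine_isometric_action dot (A n),
      forall n (k : int) v, A n.+1 (k + k) v = A n k v
    & forall n v, nm (A n 1 v - v) <= nm (alpha 1 v - v) * (3 / 4) ^+ n].
Proof.
pose halves (a a' : int -> H -> H) := affine_isometric_action dot a ->
  [/\ affine_isometric_action dot a', forall (k : int) v, a' (k + k) v = a k v
    & forall v, nm (a' 1 v - v) <= 3 / 4 * nm (a 1 v - v)].
have [F FP] : {F & forall a, halves a (F a)}.
  apply: choice => a; have [act_a|nact] := pselect (affine_isometric_action dot a).
    by have [a' a'P] := action_sqrt act_a; exists a'.
  by exists a.
have act n : affine_isometric_action dot (iter n F alpha).
  by elim: n => // n /FP[].
exists (fun n => iter n F alpha); split=> // [n k v|n v].
  by have [_ dbl _] := FP _ (act n); exact: dbl.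
elim: n => [|n IH]; first by rewrite expr0 mulr1.
have [_ _ /(_ v) le1] := FP _ (act n); rewrite exprS mulrCA.
apply: le_trans le1 _; rewrite ler_wpM2l //; lra.
Qed.

(** The linear parts v |-> f_n v - f_n 0 are contractions that converge
    strongly, so their limit is linear and norm-preserving.  Surjectivity can be
    lost in such a limit; in the flow it comes from the inverse time. *)
Lemma affine_isometry_lim (f : nat -> H -> H) (g : H -> H) :
    (forall n, affine_isometry dot (f n)) ->
    (forall v, tends (fun n => f n v) (g v)) ->
  exists2 U : {linear H -> H}, forall v, g v = U v + g 0
    & forall v, nm (U v) = nm v.
Proof.
move=> af fg.
pose part n (W : {linear H -> H}) := forall v, W v = f n v - f n 0.
have [W WE] : {W & forall n, part n (W n)}.
  apply: choice => n; have [U [b [_ fE]]] := af n; exists U => v.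
  by rewrite !fE linear0 add0r addrK.
have W1 n v : nm (W n v) = nm v by rewrite WE nm_affine ?subr0.
have WL v : tends (fun n => W n v) (g v - g 0).
  by under eq_fun do rewrite WE; apply: tendsB.
have Wc n v : nm (W n v) <= nm v by rewrite W1.
exists (linear_map (tends_linear Wc WL)) => v; first by rewrite /= subrK.
by apply: cvg_eq_lim (tends_nm (WL v)) (cvg_cst _) => n; exact: W1.
Qed.

(** floor is additive up to an error in {0, 1}, and shifting the exponent of the
    2^n-th root by 1 moves v by at most d v (3/4)^n.  This makes the
    approximations A_n (floor (2^n t)) v Cauchy and their limit additive in t.
    For 0 <= t < 2^-n the n-th approximation is v itself, so that the rate of
    convergence bounds the displacement of v by time t. *)
Lemma flow_extension : exists beta : R -> H -> H,
  [/\ affine_isometric_action dot beta,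
      forall v (e : R), 0 < e -> exists2 d : R, 0 < d &
        forall t, `|t| < d -> nm (beta t v - v) < e
    & forall (n : int) v, beta n%:~R v = alpha n v].
Proof.
have [A [A0 actA AA Ale]] := action_root_tower.
pose d v := nm (alpha 1 v - v).
pose s (n : nat) (t : R) (v : H) := A n (Num.floor (2 ^+ n * t)) v.
have q0 : 0 <= 3 / 4 :> R by lra.
have q1 : 3 / 4 < 1 :> R by lra.
have near_add n (k l m : int) v : m = k + l \/ m = k + l + 1 ->
    nm (A n m v - A n k (A n l v)) <= d v * (3 / 4) ^+ n.
  have dq0 : 0 <= d v * (3 / 4) ^+ n by rewrite mulr_ge0 ?nm_ge0 ?exprn_ge0.
  move=> [->|->]; first by rewrite actionD // subrr nm0.
  by rewrite (actionD (actA n) (k + l)) -(actionD (actA n) k) action_nm.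
have step t v n : nm (s n.+1 t v - s n t v) <= d v * (3 / 4) ^+ n.
  rewrite /s -(AA n) (actionD (actA n.+1)) exprS -mulrA mulrDl !mul1r.
  apply: le_trans (near_add _ _ _ _ _ (floorD _ _)) _.
  by rewrite exprS mulrCA ler_piMl ?mulr_ge0 ?nm_ge0 ?exprn_ge0 // ltW.
pose is_value (p : R * H) l := tends (fun n => s n p.1 p.2) l /\
  forall n, nm (l - s n p.1 p.2) <= d p.2 / (1 - 3 / 4) * (3 / 4) ^+ n.
have [beta betaP] : {beta & forall p, is_value p (beta p)}.
  by apply: choice => -[t v]; exact: geometric_cvg q0 q1 (step t v).
pose b t v := beta (t, v).
have sb t v : tends (fun n => s n t v) (b t v) := proj1 (betaP (t, v)).
have tail t v n : nm (b t v - s n t v) <= d v / (1 - 3 / 4) * (3 / 4) ^+ n.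
  exact: proj2 (betaP (t, v)) n.
have Kq0 (K : R) : K * (3 / 4) ^+ n @[n --> \oo] --> (0 : R).
  by have := @cvg_geometric R K (3 / 4); rewrite ger0_norm // => /(_ q1).
have bint (m : int) v : b m%:~R v = alpha m v.
  have pow n : A n (2 ^+ n * m) v = alpha m v.
    elim: n => [|n IH]; first by rewrite expr0 mul1r A0.
    by rewrite exprS -mulrA mulrDl !mul1r AA.
  apply: tends_unique (sb _ _) _; rewrite /s.
  have floorE n : Num.floor (2 ^+ n * m%:~R : R) = 2 ^+ n * m.
    by rewrite -[2 ^+ n]/((2 : int)%:~R ^+ n) -rmorphXn -intrM intrKfloor.
  under eq_fun => n do rewrite floorE pow.
  exact: tends_cst.
have bD t u v : b (t + u) v = b t (b u v).
  apply: tends_unique (sb _ _) _.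
  apply: (@tends_squeeze _ _ (fun n => d v * (3 / 4) ^+ n + (nm (s n u v - b u v)
     + nm (s n t (b u v) - b t (b u v))))) => [n|]; last first.
    rewrite -(addr0 0); apply: cvgD; first exact: Kq0.
    by rewrite -(addr0 0); apply: cvgD; exact: sb.
  rewrite -(subrK (s n t (s n u v)) (s n (t + u) v)) -addrA.
  apply: le_trans (nmD _ _) _; apply: lerD.
    by apply: near_add; rewrite mulrDr; exact: floorD.
  rewrite -(subrK (s n t (b u v)) (s n t (s n u v))) -addrA.
  by apply: le_trans (nmD _ _) _; apply: lerD;
    rewrite // (action_nm (actA n)).
have [_ alpha0 _] := act_alpha.
have b0 v : b 0 v = v by rewrite -[0]/(0%:~R) bint alpha0.
have baff t : affine_isometry dot (b t).
  have afs n : affine_isometry dot (s n t) by have [aff _ _] := actA n; exact: aff.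
  have [U bE U1] := affine_isometry_lim afs (sb t).
  exists U, (b t 0); split; last exact: bE.
  apply: unitary_of_nm => //; exists (fun w => b (- t) (w + b t 0)) => w.
    by rewrite -bE -bD addNr b0.
  by apply: (addIr (b t 0)); rewrite -bE -bD subrr b0.
exists b; split=> // v e e0.
have /cvgrPdist_lt /(_ _ e0) [n _ /(_ n (leqnn n))] := Kq0 (d v / (1 - 3 / 4)).
rewrite sub0r normrN => /(le_lt_trans (ler_norm _)) Kn.
have pn : 0 < 2 ^+ n :> R by rewrite exprn_gt0.
have small t : 0 <= t -> t < (2 ^+ n)^-1 -> nm (b t v - v) < e.
  move=> t0 tn; apply: le_lt_trans Kn.
  have := tail t v n; rewrite /s (@floor_def _ _ 0); last first.
    by rewrite mulr_ge0 ?(ltW pn) //= add0r -ltr_pdivlMl ?mulr1.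
  by have [_ -> _] := actA n.
exists (2 ^+ n)^-1; first by rewrite invr_gt0.
move=> t; have [t0|/ltW t0] := leP 0 t; first by rewrite ger0_norm //; exact: small.
rewrite ler0_norm // => tn.
have -> : nm (b t v - v) = nm (b (- t) v - v).
  by rewrite -(nm_affine _ _ (baff (- t))) -bD addNr b0 nmB.
by apply: small => //; rewrite oppr_ge0.
Qed.
End Flow.
End Hilbert.

Theorem proposition1p8 (R : realType) (H : completeNormedModType R[i])
    (dot : {dot H for Num.conj}) (Hdot : hilbert_form dot)
    (alpha : int -> H -> H) (Halpha : affine_isometric_action dot alpha) :
  exists beta : R -> H -> H,
    [/\ affine_isometric_action dot beta,
        continuous (fun p : R * H => beta p.1 p.2)
      & forall (n : int) (v : H), beta n%:~R v = alpha n v].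
Proof.
have [beta [act small ext]] := flow_extension Hdot Halpha.
have [aff _ betaD] := act.
exists beta; split=> // -[t v]; apply/cvgrPdist_lt => -[e e'].
rewrite ltcE /= => /andP[/eqP-> e0].
have e20 : 0 < e / 2 by rewrite divr_gt0.
have [d d0 dP] := small v _ e20.
exists (ball t d, ball v (e / 2)%:C).
  by split; [exact: nbhsx_ballx | apply: nbhsx_ballx; rewrite ltcR].
move=> [t' v'] [/=]; rewrite -!ball_normE /= !nmE ltcR => tt' vv'.
rewrite ltcR -(subrK (beta t' v) (beta t v)) -addrA.
apply: le_lt_trans (nmD _ _) _; rewrite [ltRHS](splitr e); apply: ltrD.
  rewrite -{1}(subrKC t' t) betaD.
  by rewrite (nm_affine Hdot _ _ (aff t')) dP.
by rewrite (nm_affine Hdot _ _ (aff t')).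
Qed.
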